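(* Let $\gamma:[0,1]\to\mathbb R^2$ be a $C^2$ embedded arc with $\inf_{0\le t\le1}|\gamma'(t)|>0$. If $\eta$ is a nonzero finite Borel measure supported on $\gamma([0,1])$, then $$\dim_{\mathrm F}(\eta)\le\alpha_{\min}(\eta).$$ In particular, this conclusion applies when $\gamma$ is any nondegenerate $C^2$ embedded arc, i.e. a $C^2$ embedding of $[0,1]$ with $\inf_{[0,1]}|\gamma'|>0$ and $\inf_{[0,1]}|\det(\gamma',\gamma'')|>0$.
   Context: For a finite Borel measure $\eta$ on $\mathbb R^2$, $\widehat\eta(\xi)=\int e^{-2\pi ix\cdot\xi}\,d\eta(x)$. For nonzero $\eta$, $\dim_{\mathrm F}(\eta)=\sup\{0\le\sigma\le2:\ |\widehat\eta(\xi)|=O(|\xi|^{-\sigma/2})\text{ as }|\xi|\to\infty\}$ and $$\alpha_{\min}(\eta)=\inf_{x\in\operatorname{spt}\eta}\ \liminf_{\rho\downarrow0}\frac{\log_2\eta(B(x,\rho))}{\log_2\rho}.$$ *)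

(* Defs.v *)
From HB Require Import structures.
From mathcomp Require Import all_boot all_order all_algebra.
From mathcomp Require Import all_classical all_reals all_analysis.
From mathcomp Require Import complex.

Set Implicit Arguments.
Unset Strict Implicit.
Unset Printing Implicit Defensive.

Import Order.TTheory GRing.Theory Num.Theory.
Import numFieldNormedType.Exports.

Local Open Scope classical_set_scope.
Local Open Scope ring_scope.

(** The plane is [R * R].  Its library norm is the sup norm, so the Euclidean
    norm is introduced separately.  Its product sigma-algebra is the Borel one,
    since [R] is second countable. *)

Definition dot (R : realType) (x y : R * R) : R := x.1 * y.1 + x.2 * y.2.

Definition enorm (R : realType) (x : R * R) : R := Num.sqrt (dot x x).

Definition det2 (R : realType) (u v : R * R) : R := u.1 * v.2 - u.2 * v.1.

Definition eball (R : realType) (x : R * R) (rho : R) : set (R * R) :=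
  [set y | enorm (y - x) < rho].

(** Curves on [0, 1] are functions on all of [R] whose values outside [0, 1] are
    irrelevant: derivatives are taken within [0, 1], hence are one-sided at the
    endpoints. *)

Definition diffquot01 (R : realType) (f : R -> R) (t s : R) : R :=
  (f s - f t) / (s - t).

Definition derivable01 (R : realType) (f : R -> R) (t : R) : Prop :=
  cvg (diffquot01 f t @ within `[0, 1] t^').

Definition deriv01 (R : realType) (f : R -> R) (t : R) : R :=
  lim (diffquot01 f t @ within `[0, 1] t^').

Definition C1_01 (R : realType) (f : R -> R) : Prop :=
  (forall t, t \in `[0, 1] -> derivable01 f t) /\
  {within `[0, 1], continuous (deriv01 f)}.

Definition C2_01 (R : realType) (f : R -> R) : Prop :=
  C1_01 f /\ C1_01 (deriv01 f).

Definition velocity (R : realType) (gamma : R -> R * R) (t : R) : R * R :=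
  (deriv01 (fst \o gamma) t, deriv01 (snd \o gamma) t).

Definition acceleration (R : realType) (gamma : R -> R * R) : R -> R * R :=
  velocity (velocity gamma).

(** By compactness of [0, 1], continuity and injectivity already make the curve
    a homeomorphism onto its image. *)
Definition C2_embedded_arc (R : realType) (gamma : R -> R * R) : Prop :=
  [/\ C2_01 (fst \o gamma), C2_01 (snd \o gamma) &
      {in `[0, 1] &, injective gamma}].

Definition regular_C2_arc (R : realType) (gamma : R -> R * R) : Prop :=
  C2_embedded_arc gamma /\
  0 < inf [set enorm (velocity gamma t) | t in `[0, 1]].

Definition nondegenerate_C2_arc (R : realType) (gamma : R -> R * R) : Prop :=
  regular_C2_arc gamma /\
  0 < inf [set `|det2 (velocity gamma t) (acceleration gamma t)|
          | t in `[0, 1]].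

(** Real and imaginary parts of the integral of [exp (- 2 pi i x.xi)]. *)
Definition fourier (R : realType) (eta : {finite_measure set (R * R)%type -> \bar R})
    (xi : R * R) : R[i] :=
  Complex (Rintegral eta setT (fun x => cos (2 * pi * dot x xi)))
          (- Rintegral eta setT (fun x => sin (2 * pi * dot x xi))).

Definition fourier_decay (R : realType)
    (eta : {finite_measure set (R * R)%type -> \bar R}) (sigma : R) : Prop :=
  exists C M : R, forall xi : R * R, M <= enorm xi ->
    ComplexField.Normc.normc (fourier eta xi) <= C * enorm xi `^ (- sigma / 2).

Definition fourier_dim (R : realType)
    (eta : {finite_measure set (R * R)%type -> \bar R}) : R :=
  sup [set sigma : R | 0 <= sigma <= 2 /\ fourier_decay eta sigma].

Definition spt (R : realType) (eta : {finite_measure set (R * R)%type -> \bar R}) :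
    set (R * R) :=
  [set x | forall U : set (R * R), open U -> U x -> (0 < eta U)%E].

Definition log2 (R : realType) (x : R) : R := ln x / ln 2.

(** In [\bar R], as the local dimension may be infinite.  At points of the
    support [eta (eball x rho)] is positive and finite, so neither [fine] nor
    [ln] is evaluated at a junk value. *)
Definition lower_local_dim (R : realType)
    (eta : {finite_measure set (R * R)%type -> \bar R}) (x : R * R) : \bar R :=
  limf_einf (fun rho : R => (log2 (fine (eta (eball x rho))) / log2 rho)%:E)
    (0 : R)^'+.

Definition alpha_min (R : realType)
    (eta : {finite_measure set (R * R)%type -> \bar R}) : \bar R :=
  ereal_inf [set lower_local_dim eta x | x in spt eta].

(* Main.v *)
(** At [x = gamma t0] let [n] be normal to the arc.  Since [gamma] is C^2 and
    regular, the part of the arc in the ball of radius [rho] about [x] lies in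
    the strip [|(y - x).n| <= K rho^2].  The mass of a strip of half-width [d] is
    controlled by the Fourier transform along the single line [R n]: integrating
    the Fejer kernel [sum_(j, k < N) cos ((j - k) theta)], with
    [theta = 2 pi (y - x).n] and [N] of order [1 / d], gives
    [eta (strip) <= C N^(-2) sum_(j, k < N) |eta^ ((j - k) n)| = O(d^s)]
    whenever [|eta^ (xi)| = O(|xi|^(-s))] with [s < 1].  With [d = K rho^2] the
    ball has mass [O(rho^(2 s))], so the lower local dimension at [x] is at least
    [2 s]; let [2 s] tend to the Fourier dimension. *)

Require Import Defs.
From HB Require Import structures.
From mathcomp Require Import all_boot all_order all_algebra.
From mathcomp Require Import all_classical all_reals all_analysis.
From mathcomp Require Import complex.
From mathcomp Require Import measurable_realfun ring lra.
Import Order.TTheory GRing.Theory Num.Theory.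
Import numFieldNormedType.Exports.
Local Open Scope classical_set_scope.
Local Open Scope ring_scope.

(** * One-variable calculus within [0, 1]: linear approximation, mean value theorem, quadratic
    Taylor bound *)

(** Clearing the denominator of the difference quotient extends the estimate to [s = t], a point
    that the punctured filter leaves out. *)
Lemma derivable01_near (R : realType) (f : R -> R) (t : R) :
  derivable01 f t -> forall e : R, 0 < e ->
  exists2 d : R, 0 < d & forall s, s \in `[0, 1] -> `|s - t| < d ->
    `|f s - f t - deriv01 f t * (s - t)| <= e * `|s - t|.
Proof.
move=> h e e0.
have : diffquot01 f t @ within `[0, 1] t^' --> deriv01 f t by exact: h.
move/cvgrPdist_le => /(_ _ e0); rewrite near_withinE /dnbhs near_withinE.
case/nbhs_ballP => d /= d0 hd; exists d => // s s01 st.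
have [->|nst] := eqVneq s t; first by rewrite !subrr mulr0 subr0 normr0 mulr0.
have st0 : s - t != 0 by rewrite subr_eq0.
have := hd s; rewrite /ball /= distrC => /(_ st nst s01).
rewrite /diffquot01 => hs.
have -> : f s - f t - deriv01 f t * (s - t) =
    - ((deriv01 f t - (f s - f t) / (s - t)) * (s - t)) by field.
by rewrite normrN normrM ler_wpM2r.
Qed.

Lemma derivable01_continuous (R : realType) (f : R -> R) :
  (forall t, t \in `[0, 1] -> derivable01 f t) ->
  {within `[0, 1], continuous f}.
Proof.
move=> df; apply/subspace_continuousP => t t01.
have [d d0 hd] := derivable01_near _ _ _ (df t t01) 1 ltr01.
apply/cvgrPdist_lt => e e0; rewrite near_withinE.
pose K := 1 + `|deriv01 f t|.
have K0 : 0 < K by rewrite ltr_pwDl.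
apply/nbhs_ballP; exists (Num.min d (e / K)); first by rewrite /= lt_min d0 divr_gt0.
move=> s; rewrite /ball /= distrC lt_min => /andP[sd se] s01.
have := hd s s01 sd; rewrite mul1r => hs.
rewrite distrC.
apply: (@le_lt_trans _ _ (K * `|s - t|)); last by rewrite mulrC -ltr_pdivlMr.
rewrite mulrDl mul1r -normrM.
have -> : f s - f t = (f s - f t - deriv01 f t * (s - t)) + deriv01 f t * (s - t).
  by ring.
by rewrite (le_trans (ler_normD _ _))// lerD2r.
Qed.

(** At a point strictly between [a] and [b] small increments stay in [0, 1], so the derivative
    within [0, 1] is the two-sided one and the classical mean value theorem applies. *)
Lemma MVT01 (R : realType) (f : R -> R) (a b : R) :
  (forall t, t \in `[0, 1] -> derivable01 f t) ->
  a \in `[0, 1] -> b \in `[0, 1] -> a < b ->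
  exists2 c : R, c \in `]a, b[ & f b - f a = deriv01 f c * (b - a).
Proof.
move=> df; rewrite !in_itv /= => /andP[a0 a1] /andP[b0 b1] ab.
apply: MVT => //; last first.
  apply: continuous_subspaceW (derivable01_continuous _ _ df).
  move=> x /=; rewrite !in_itv /= => /andP[ax xb].
  by rewrite (le_trans a0 ax) (le_trans xb b1).
move=> x; rewrite in_itv /= => /andP[ax xb].
have x01 : x \in `[0, 1].
  by rewrite in_itv /= (le_trans a0 (ltW ax)) (le_trans (ltW xb) b1).
have h : h^-1 *: (f (h *: 1 + x) - f x) @[h --> 0^'] --> deriv01 f x.
  apply/cvgrPdist_le => e e0.
  have [d d0 hd] := derivable01_near _ _ _ (df x x01) e e0.
  rewrite /dnbhs near_withinE; apply/nbhs_ballP.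
  exists (Num.min d (Num.min (x - a) (b - x))).
    by rewrite /= !lt_min d0 !subr_gt0 ax xb.
  move=> k; rewrite /ball /= sub0r normrN !lt_min => /and3P[kd ka kb] k0.
  have kE : (k *: 1 + x) = k + x by rewrite /GRing.scale /= mulr1.
  rewrite kE.
  have kx : k + x - x = k by rewrite addrK.
  have /hd : k + x \in `[0, 1].
    by move: ka kb; rewrite !ltr_norml in_itv /= => /andP[? ?] /andP[? ?]; lra.
  rewrite kx => /(_ kd) hk.
  have -> : deriv01 f x - k^-1 *: (f (k + x) - f x) =
    - (k^-1 * (f (k + x) - f x - deriv01 f x * k)).
    by rewrite /GRing.scale /=; field.
  by rewrite normrN normrM normfV mulrC ler_pdivrMr ?normr_gt0.
apply: DeriveDef; first by apply/cvg_ex; exists (deriv01 f x).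
exact: cvg_lim h.
Qed.

(** Differentiability of [f'] at [t0] gives [|f'(c) - f'(t0)| <= K |c - t0|]. The mean value theorem
    turns the error into [(f'(c) - f'(t0)) (t - t0)] with [c] between [t0] and [t]. *)
Lemma taylor01 (R : realType) (f : R -> R) (t0 : R) :
  C2_01 f -> t0 \in `[0, 1] ->
  exists K d : R, [/\ 0 < K, 0 < d & forall t, t \in `[0, 1] -> `|t - t0| < d ->
    `|f t - f t0 - deriv01 f t0 * (t - t0)| <= K * (t - t0) ^+ 2].
Proof.
move=> [[df _] [ddf _]] t01.
have [d d0 hd] := derivable01_near _ _ _ (ddf t0 t01) 1 ltr01.
pose K := 1 + `|deriv01 (deriv01 f) t0|.
have K0 : 0 < K by rewrite ltr_pwDl.
have hK s : s \in `[0, 1] -> `|s - t0| < d ->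
    `|deriv01 f s - deriv01 f t0| <= K * `|s - t0|.
  move=> s01 sd; have := hd s s01 sd; rewrite mul1r => hs.
  rewrite mulrDl mul1r -normrM.
  have -> : deriv01 f s - deriv01 f t0 = (deriv01 f s - deriv01 f t0 -
    deriv01 (deriv01 f) t0 * (s - t0)) + deriv01 (deriv01 f) t0 * (s - t0).
    by ring.
  by rewrite (le_trans (ler_normD _ _))// lerD2r.
exists K, d; split => // t tt01 td.
suff [c [c01 ct ->]] : exists c, [/\ c \in `[0, 1], `|c - t0| <= `|t - t0| &
    f t - f t0 = deriv01 f c * (t - t0)].
  rewrite -mulrBl normrM -real_normK ?num_real// expr2 mulrA ler_wpM2r//.
  by apply: (le_trans (hK c c01 (le_lt_trans ct td))); rewrite ler_wpM2l // ltW.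
move: (t01) (tt01); rewrite !in_itv /= => /andP[? ?] /andP[? ?].
have [lt|lt|->] := ltgtP t t0.
- have [c ch e] := MVT01 _ _ _ _ df tt01 t01 lt; exists c.
  move: ch; rewrite !in_itv /= => /andP[? ?]; split; first by lra.
    by rewrite !ltr0_norm; lra.
  by rewrite -[LHS]opprB e; ring.
- have [c ch e] := MVT01 _ _ _ _ df t01 tt01 lt; exists c.
  move: ch; rewrite !in_itv /= => /andP[? ?]; split; first by lra.
    by rewrite !gtr0_norm; lra.
  by [].
- by exists t0; split; rewrite ?subrr ?mulr0 // ?in_itv /=; lra.
Qed.

(** * Euclidean norm and Borel sets of the plane *)

Lemma enorm_ge_fst (R : realType) (x : R * R) : `|x.1| <= enorm x.
Proof. by rewrite -sqrtr_sqr ler_wsqrtr// /dot expr2 lerDl -expr2 sqr_ge0. Qed.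

Lemma enorm_ge_snd (R : realType) (x : R * R) : `|x.2| <= enorm x.
Proof. by rewrite -sqrtr_sqr ler_wsqrtr// /dot expr2 lerDr -expr2 sqr_ge0. Qed.

Lemma enorm_ge0 (R : realType) (x : R * R) : 0 <= enorm x.
Proof. exact: sqrtr_ge0. Qed.

Lemma enormZ (R : realType) (k : R) (x : R * R) : enorm (k *: x) = `|k| * enorm x.
Proof.
rewrite /enorm -sqrtr_sqr -sqrtrM ?sqr_ge0//; congr Num.sqrt.
by rewrite /dot /= /GRing.scale /=; ring.
Qed.

(** An open set is the union of the countably many squares with rational centre and radius that it
    contains, and a square is a product of two intervals. *)
Lemma open_measurable_plane (R : realType) (U : set (R * R)) :
  open U -> measurable U.
Proof.
move=> oU.
pose box (q : rat * rat * rat) : set (R * R) :=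
  ball (ratr q.1.1 : R) (ratr q.2) `*` ball (ratr q.1.2 : R) (ratr q.2).
have -> : U = \bigcup_q (if `[< box q `<=` U >] then box q else set0).
  apply/seteqP; split => [x Ux|x [q _]]; last by case: asboolP => // qU /qU.
  move: (oU); rewrite openE => /(_ x Ux); rewrite /interior => /nbhs_ballP[e /= e0 he].
  have [r] := rat_in_itvoo (divr_gt0 e0 (ltr0n R 2)).
  rewrite in_itv /= => /andP[r0 re].
  have near_rat (y : R) : exists a : rat, `|y - ratr a| < ratr r.
    have [a] := @rat_in_itvoo R (y - ratr r) (y + ratr r) ltac:(lra).
    by rewrite in_itv /= => /andP[? ?]; exists a; rewrite ltr_distl; apply/andP; split; lra.
  have [a ha] := near_rat x.1; have [b hb] := near_rat x.2.
  have sub : box (a, b, r) `<=` U.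
    move=> y [/= y1 y2]; apply: he; split; rewrite /ball /=.
      rewrite (le_lt_trans (ler_distD (ratr a) _ _))//.
      by move: y1; rewrite /ball /= => y1; lra.
    rewrite (le_lt_trans (ler_distD (ratr b) _ _))//.
    by move: y2; rewrite /ball /= => y2; lra.
  by exists (a, b, r) => //; case: asboolP => // _; split; rewrite /ball /= distrC.
apply: countable_bigcupT_measurable; first exact: countableP.
move=> q; case: asboolP => _; last exact: measurable0.
by apply: measurableX; exact: measurable_ball.
Qed.

(** * Geometry of the arc: closed image, and the strip around a tangent line *)

Lemma arc_continuous (R : realType) (gamma : R -> R * R) :
  C2_embedded_arc gamma -> {within `[0, 1], continuous gamma}.
Proof.
move=> [[[d1 _] _] [[d2 _] _] _].
move/derivable01_continuous/subspace_continuousP : d1 => c1.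
move/derivable01_continuous/subspace_continuousP : d2 => c2.
apply/subspace_continuousP => t t01.
rewrite /from_subspace.
have -> : gamma = (fun x => ((fst \o gamma) x, (snd \o gamma) x)).
  by apply/funext => s /=; rewrite -surjective_pairing.
exact: cvg_pair (c1 t t01) (c2 t t01).
Qed.

(** A continuous image of a compact set is compact, hence closed. The set [A] makes it possible to
    cut a neighbourhood of one parameter out of the arc. *)
Lemma arc_image_closed (R : realType) (gamma : R -> R * R) (A : set R) :
  C2_embedded_arc gamma -> closed A -> closed (gamma @` (`[0, 1] `&` A)).
Proof.
move=> arc cA; apply: compact_closed; first exact: norm_hausdorff.
apply: continuous_compact; last first.
  by apply: compact_closedI => //; exact: segment_compact.
by apply: continuous_subspaceW (arc_continuous _ _ arc) => x [].
Qed.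

(* Injectivity turns closeness in the plane into closeness of parameters. *)
Lemma arc_param_close (R : realType) (gamma : R -> R * R) (t0 d : R) :
  C2_embedded_arc gamma -> t0 \in `[0, 1] -> 0 < d ->
  exists2 r : R, 0 < r & forall t, t \in `[0, 1] ->
    enorm (gamma t - gamma t0) < r -> `|t - t0| < d.
Proof.
move=> arc t01 d0.
(* The part of the arc with parameters at distance at least [d] from [t0] is closed and misses
   [gamma t0], so a whole ball around [gamma t0] avoids it. *)
have cl : closed (gamma @` (`[0, 1] `&` ~` ball t0 d)).
  by apply: arc_image_closed => //; apply: open_closedC; exact: ball_open.
have out : (~` (gamma @` (`[0, 1] `&` ~` ball t0 d))) (gamma t0).
  move=> [t /= [tt01 tb]]; case: arc => _ _ inj /(inj _ _ tt01 t01) e.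
  by apply: tb; rewrite e; exact: ballxx.
move: (closed_openC cl); rewrite openE => /(_ _ out).
rewrite /interior => /nbhs_ballP[r /= r0 hr]; exists r => // t tt01 tr.
rewrite ltNge; apply/negP => dt.
apply: (hr (gamma t)).
  split; rewrite /ball /= distrC.
    exact: le_lt_trans (enorm_ge_fst _ (gamma t - gamma t0)) tr.
  exact: le_lt_trans (enorm_ge_snd _ (gamma t - gamma t0)) tr.
exists t => //; split => //; rewrite /ball /= distrC => h.
by move: dt; rewrite leNgt h.
Qed.

(* [n] is normal to the arc at [t0] (not normalized). *)
Lemma arc_in_strip (R : realType) (gamma : R -> R * R) (t0 : R) :
  regular_C2_arc gamma -> t0 \in `[0, 1] ->
  exists (n : R * R) (K r : R), [/\ 0 < enorm n, 0 < K, 0 < r &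
    forall t rho, t \in `[0, 1] -> rho < r -> enorm (gamma t - gamma t0) < rho ->
      `|dot (gamma t - gamma t0) n| <= K * rho ^+ 2].
Proof.
move=> [arc reg] t01.
have v0 : 0 < enorm (velocity gamma t0).
  apply: lt_le_trans reg _; apply: ge_inf; last by exists t0.
  by exists 0 => _ [t _ <-]; exact: enorm_ge0.
case: (arc) => c1 c2 _.
have [K1 [d1 [K10 d10 h1]]] := taylor01 _ _ _ c1 t01.
have [K2 [d2 [K20 d20 h2]]] := taylor01 _ _ _ c2 t01.
move: v0 h1 h2; rewrite [velocity _ _]surjective_pairing /velocity /=.
set a := deriv01 _ t0; set b := deriv01 _ t0 => v0 h1 h2.
have vv : 0 < a * a + b * b by move: v0; rewrite /enorm /dot /= sqrtr_gt0.
pose A := `|a| + `|b|; pose K := K1 + K2.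
have A0 : 0 < A.
  rewrite lt_neqAle addr_ge0 // andbT eq_sym paddr_eq0 // !normr_eq0.
  by apply/negP => /andP[/eqP a0 /eqP b0]; move: vv; rewrite a0 b0; lra.
have K0 : 0 < K by rewrite addr_gt0.
pose V := a * a + b * b.
(* For [|u|] below this bound the quadratic error [A * K * u ^+ 2] is at most [V / 2 * |u|], half of
   the tangential main term. *)
have d30 : 0 < V / (2 * A * K) by rewrite divr_gt0 ?mulr_gt0.
have [r r0 hr] := arc_param_close _ _ t0 (Num.min d1 (Num.min d2 (V / (2 * A * K))))
  arc t01 ltac:(by rewrite !lt_min d10 d20).
exists (- b, a), (A * K * (2 * A / V) ^+ 2), r; split => //.
- by rewrite /enorm /dot /= sqrtr_gt0 addrC mulrNN.
- apply: mulr_gt0; first exact: mulr_gt0.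
  by apply: exprn_gt0; apply: divr_gt0 => //; exact: mulr_gt0.
move=> t rho tt01 rr wrho; have := hr _ tt01 (lt_trans wrho rr).
rewrite !lt_min => /and3P[td1 td2 td3].
have := h1 t tt01 td1; have := h2 t tt01 td2.
have w1 := le_lt_trans (enorm_ge_fst _ (gamma t - gamma t0)) wrho.
have w2 := le_lt_trans (enorm_ge_snd _ (gamma t - gamma t0)) wrho.
move: w1 w2; rewrite /dot /=.
set w1 := _ - (gamma t0).1; set w2 := _ - (gamma t0).2; set u := t - t0.
move=> w1r w2r e2 e1.
(* Taylor error in a direction [(x, y)]; it serves for the tangent [(a, b)] and for the normal
   [(- b, a)]. *)
have comb x y : `|x| <= A -> `|y| <= A ->
    `|x * (w1 - a * u) + y * (w2 - b * u)| <= A * K * u ^+ 2.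
  move=> xA yA; rewrite (le_trans (ler_normD _ _))// !normrM.
  have -> : A * K * u ^+ 2 = A * (K1 * u ^+ 2) + A * (K2 * u ^+ 2).
    by rewrite /K; ring.
  by rewrite lerD// ler_pM.
have aA : `|a| <= A by rewrite lerDl.
have bA : `|b| <= A by rewrite lerDr.
(* The tangential component of the displacement is [V * u] up to [V / 2 * |u|] and is at most
   [A * rho]; absorbing the error leaves [|u| = O(rho)]. *)
have ur : `|u| <= 2 * A / V * rho.
  have h := comb a b aA bA.
  have u2 : A * K * u ^+ 2 <= V / 2 * `|u|.
    rewrite -real_normK ?num_real// expr2 mulrA ler_wpM2r//.
    move: td3; rewrite ltr_pdivlMr ?mulr_gt0// -/u => td3.
    have e : `|u| * (2 * A * K) = 2 * (A * K * `|u|) by ring.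
    by move: td3; rewrite e; lra.
  have dv : `|w1 * a + w2 * b| <= A * rho.
    rewrite (le_trans (ler_normD _ _))// !normrM mulrDl.
    by rewrite lerD// mulrC ler_wpM2l// ltW.
  have Vu : V * `|u| <= V / 2 * `|u| + A * rho.
    rewrite -[V in V * _]gtr0_norm// -normrM.
    have -> : V * u = (w1 * a + w2 * b) - (a * (w1 - a * u) + b * (w2 - b * u)).
      by rewrite /V; ring.
    by rewrite (le_trans (ler_normB _ _))// addrC lerD// (le_trans h).
  rewrite mulrAC ler_pdivlMr//.
  have e : V / 2 * `|u| = V * `|u| / 2 by rewrite mulrAC.
  by move: Vu; rewrite e [`|u| * V]mulrC; lra.
(* In the normal direction the terms linear in [u] cancel, so only the quadratic error remains. *)
have := comb (- b) a ltac:(by rewrite normrN) aA.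
have -> : - b * (w1 - a * u) + a * (w2 - b * u) = w1 * - b + w2 * a by ring.
move/le_trans; apply.
rewrite -[_ * rho ^+ 2]mulrA -exprMn ler_wpM2l ?mulr_ge0 ?(ltW A0) ?(ltW K0)//.
rewrite -real_normK ?num_real// lerXn2r// nnegrE//.
exact: le_trans (normr_ge0 _) ur.
Qed.

(** * Double sums of negative powers of [|j - k| + 1] *)

(** Discrete form of comparing [x^(a - 1)] with the derivative of [x^a / a]; it makes sums of powers
    telescope. *)
Lemma powR_increment (R : realType) (a : R) (m : nat) : 0 < a <= 1 ->
  a * m.+1%:R `^ (a - 1) <= m.+1%:R `^ a - m%:R `^ a.
Proof.
move=> /andP[a0 a1].
have m0 : 0 < m.+1%:R :> R by [].
have -> : m.+1%:R `^ (a - 1) = m.+1%:R `^ a / m.+1%:R :> R.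
  rewrite powRB ?powRr1 ?(ltW m0)//.
  by apply/implyP => _; rewrite gt_eqF.
case: m m0 => [|m] m0.
  by rewrite powR1 divr1 mulr1 powR0 ?subr0 ?(gt_eqF a0).
pose z : R := m.+1%:R / m.+2%:R.
have z0 : 0 < z by rewrite divr_gt0.
have mE : m.+1%:R = m.+2%:R * z :> R by rewrite /z mulrC divfK ?pnatr_eq0.
(* Bernoulli's inequality, from concavity of [ln] at the points [1] and [z] with weights [1 - a] and
   [a]. *)
have bern : z `^ a <= 1 + a * (z - 1).
  have b0 : 0 < 1 + a * (z - 1) by nra.
  rewrite -ler_ln ?posrE ?powR_gt0// ln_powR.
  have ha : 0 <= 1 - a <= 1 by apply/andP; split; lra.
  have := @concave_ln R (Itv01 (proj1 (andP ha)) (proj2 (andP ha))) 1 z ltr01 z0.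
  rewrite !convRE /= ln1 mulr0 add0r mulr1 /unstable.onem.
  have e1 : 1 - (1 - a) = a by ring.
  have e2 : 1 - a + a * z = 1 + a * (z - 1) by ring.
  by rewrite e1 e2.
rewrite [in X in _ <= _ - X]mE powRM ?(ltW z0)//.
have p0 : 0 < m.+2%:R `^ a :> R by exact: powR_gt0.
have zE : m.+2%:R^-1 = 1 - z :> R.
  rewrite /z; apply: (mulIf (x := m.+2%:R)); first by rewrite pnatr_eq0.
  by rewrite mulrBl mulVf ?divfK ?pnatr_eq0// mul1r -natrB// subSnn.
rewrite zE; nra.
Qed.

(** Induction on [N], telescoping by [powR_increment]. Truncated subtraction lets one formula cover
    both sides of the diagonal: [N - j] is [0] while [N <= j], and [j.+1 - N] is [0] once
    [N > j]. *)
Lemma sum_powR_dist_le (R : realType) (s : R) (j N : nat) : 0 <= s < 1 ->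
  (1 - s) * \sum_(k < N) (`|j%:R - k%:R| + 1) `^ (- s) <=
  j.+1%:R `^ (1 - s) + (N - j)%:R `^ (1 - s) - (j.+1 - N)%:R `^ (1 - s).
Proof.
move=> /andP[s0 s1].
have a01 : 0 < 1 - s <= 1 by apply/andP; split; lra.
have inc m : (1 - s) * m.+1%:R `^ (- s) <= m.+1%:R `^ (1 - s) - m%:R `^ (1 - s) :> R.
  by have := powR_increment _ _ m a01; rewrite (_ : 1 - s - 1 = - s)//; ring.
have a0 : 1 - s != 0 by lra.
elim: N => [|N IH].
  by rewrite big_ord0 mulr0 sub0n subn0 powR0// addr0 subrr.
rewrite big_ord_recr /= mulrDr.
have [jN|Nj] := leqP j N.
- have := inc (N - j)%N; rewrite -subSn//.
  have -> : `|j%:R - N%:R| + 1 = (N.+1 - j)%:R :> R.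
    by rewrite distrC -natrB// normr_nat natr1 subSn.
  have -> : (j.+1 - N.+1)%N = 0%N by apply/eqP; rewrite subn_eq0.
  have := powR_ge0 (j.+1 - N)%:R (1 - s) : 0 <= _ :> R.
  rewrite powR0// => ? ?.
  by move: IH; lra.
- have := inc (j - N)%N; rewrite -subSn ?(ltnW Nj)//.
  have -> : `|j%:R - N%:R| + 1 = (j.+1 - N)%:R :> R.
    by rewrite -natrB ?(ltnW Nj)// normr_nat natr1 subSn ?(ltnW Nj).
  rewrite subSS.
  have -> : (N.+1 - j)%N = 0%N by apply/eqP; rewrite subn_eq0.
  have e : (N - j)%N = 0%N by apply/eqP; rewrite subn_eq0 ltnW.
  by move: IH; rewrite e; lra.
Qed.

(** Each of the [N] rows is at most [2 / (1 - s) * N^(1 - s)]. The factor [N ^+ 2] is kept apart so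
    that it cancels against the lower bound of the Fejer kernel. *)
Lemma sum2_powR_dist_le (R : realType) (s : R) (N : nat) : 0 <= s < 1 ->
  \sum_(j < N) \sum_(k < N) (`|j%:R - k%:R| + 1) `^ (- s) <=
  2 / (1 - s) * (N%:R ^+ 2 * N%:R `^ (- s)) :> R.
Proof.
move=> s01; have [s0 s1] := andP s01.
have a0 : 0 < 1 - s by lra.
have row (j : 'I_N) : \sum_(k < N) (`|j%:R - k%:R| + 1) `^ (- s) <=
    2 / (1 - s) * (N%:R * N%:R `^ (- s)) :> R.
  have N0 : (0 < N)%N by apply: leq_ltn_trans (ltn_ord j).
  have Na : N%:R * N%:R `^ (- s) = N%:R `^ (1 - s) :> R.
    rewrite -{1}[N%:R]powRr1// -powRD//.
    by apply/implyP => _; rewrite pnatr_eq0 -lt0n.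
  rewrite Na mulrAC ler_pdivlMr// mulrC.
  apply: (le_trans (sum_powR_dist_le _ _ j N s01)).
  have h m : (m <= N)%N -> m%:R `^ (1 - s) <= N%:R `^ (1 - s) :> R.
    by move=> mN; rewrite ge0_ler_powR ?nnegrE ?ler_nat// ltW.
  have := h _ (ltn_ord j); have := h _ (leq_subr j N).
  by have := powR_ge0 (j.+1 - N)%:R (1 - s) : 0 <= _ :> R; lra.
apply: (le_trans (ler_sum _ (fun j _ => row j))).
rewrite sumr_const card_ord -mulr_natl le_eqVlt; apply/orP; left; apply/eqP.
by ring.
Qed.

(** * Integrating the Fejer kernel against a finite measure *)

Lemma bounded_Rintegrable (d : measure_display) (T : measurableType d)
    (R : realType) (mu : {finite_measure set T -> \bar R}) (f : T -> R) (M : R) :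
  measurable_fun setT f -> (forall y, `|f y| <= M) ->
  mu.-integrable setT (EFin \o f).
Proof.
move=> mf bf; apply: measurable_bounded_integrable => //.
  by rewrite ltey_eq fin_num_measure.
exists M; split; first exact: num_real.
by move=> x Mx y _ /=; exact: le_trans (bf y) (ltW Mx).
Qed.

(** Integrability and value go through one induction, since additivity of the integral asks for an
    integrable tail. *)
Lemma Rintegral_sum (d : measure_display) (T : measurableType d)
    (R : realType) (mu : {measure set T -> \bar R}) (D : set T) (I : Type)
    (s : seq I) (f : I -> T -> R) : measurable D ->
  (forall i, mu.-integrable D (EFin \o f i)) ->
  mu.-integrable D (EFin \o (fun x => \sum_(i <- s) f i x)) /\
  Rintegral mu D (fun x => \sum_(i <- s) f i x) = \sum_(i <- s) Rintegral mu D (f i).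
Proof.
move=> mD intf; elim: s => [|i s [IHi IHe]].
  have -> : (fun x => \sum_(i <- [::]) f i x) = cst 0.
    by apply/funext => x; rewrite big_nil.
  by rewrite big_nil Rintegral_cst// mul0r; split => //; exact: integrable0.
have E : (fun x => \sum_(j <- i :: s) f j x) =
    (fun x => f i x + \sum_(j <- s) f j x).
  by apply/funext => x; rewrite big_cons.
rewrite E; split; last by rewrite RintegralD// big_cons IHe.
exact: integrableD (intf i) IHi.
Qed.

(* Both sides are the Fejer kernel [|sum_(j < N) e^(i j x)|^2]. *)
Lemma double_sum_cosB (R : realType) (N : nat) (x : R) :
  \sum_(j < N) \sum_(k < N) cos ((j%:R - k%:R) * x) =
  (\sum_(j < N) cos (j%:R * x)) ^+ 2 + (\sum_(j < N) sin (j%:R * x)) ^+ 2.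
Proof.
rewrite !expr2 !mulr_suml -big_split /=; apply: eq_bigr => j _.
rewrite !mulr_sumr -big_split /=; apply: eq_bigr => k _.
by rewrite mulrBl cosB.
Qed.

Lemma measurable_norm_le (d : measure_display) (T : measurableType d)
    (R : realType) (g : T -> R) (c : R) :
  measurable_fun setT g -> measurable [set y | `|g y| <= c].
Proof.
move=> mg; have mle : measurable_fun setT (fun y => `|g y| <= c).
  by apply: measurable_fun_ler => //; exact: measurableT_comp.
by have := mle measurableT [set true] I; rewrite setTI.
Qed.

(** Where [|N g| <= c] all of [cos (j g)], [j < N], are at least [1/2], so the kernel is at least
    [(N / 2)^2]; elsewhere it is nonnegative, being a sum of squares. *)
Lemma fejer_le (d : measure_display) (T : measurableType d) (R : realType)
    (mu : {finite_measure set T -> \bar R}) (g : T -> R) (c : R) (N : nat) :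
  measurable_fun setT g -> (forall z : R, `|z| <= c -> 2^-1 <= cos z) ->
  N%:R ^+ 2 / 4 * fine (mu [set y | `|N%:R * g y| <= c]) <=
  \sum_(j < N) \sum_(k < N) Rintegral mu setT (fun y => cos ((j%:R - k%:R) * g y)).
Proof.
move=> mg hc; set S := [set y | _].
have mS : measurable S by apply: measurable_norm_le; exact: measurable_funM.
have icos r : mu.-integrable setT (EFin \o (fun y => cos (r * g y))).
  apply: (bounded_Rintegrable _ _ _ _ _ 1) => [|y]; last exact: cos_max.
  apply: measurableT_comp; first by apply: continuous_measurable_fun; exact: continuous_cos.
  exact: measurable_funM.
have sums j := Rintegral_sum _ _ _ mu setT _ (index_enum 'I_N)
  (fun k y => cos ((j%:R - k%:R) * g y)) measurableT (fun k => icos _).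
have [isum esum] := Rintegral_sum _ _ _ mu setT _ (index_enum 'I_N)
  (fun j y => \sum_(k < N) cos ((j%:R - k%:R) * g y)) measurableT (fun j => (sums j).1).
under eq_bigr do rewrite -(sums _).2.
rewrite -esum.
have -> : N%:R ^+ 2 / 4 * fine (mu S) =
    Rintegral mu setT (fun y => N%:R ^+ 2 / 4 * \1_S y).
  rewrite RintegralZl//; last exact: integrable_indic.
  by rewrite /Rintegral integral_indic// setIT.
apply: le_Rintegral => //.
  apply: (bounded_Rintegrable _ _ _ _ _ (N%:R ^+ 2 / 4)) => [|y].
    by apply: measurable_funM => //; exact: measurable_indic.
  rewrite normrM ger0_norm; last by rewrite divr_ge0// exprn_ge0.
  rewrite ler_piMr ?divr_ge0 ?exprn_ge0//.
  by rewrite indicE; case: (y \in S); rewrite ?normr1 ?normr0.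
move=> y _; rewrite double_sum_cosB indicE.
have [|_] := boolP (y \in S); last by rewrite mulr0 addr_ge0// sqr_ge0.
rewrite inE /S /= mulr1 => yS.
apply: ler_wpDr; first exact: sqr_ge0.
rewrite (_ : N%:R ^+ 2 / 4 = (N%:R / 2) ^+ 2); last by field.
have h : N%:R / 2 <= \sum_(j < N) cos (j%:R * g y).
  rewrite -[N in X in X <= _]card_ord -mulr_natl mulr1 mulrC mulr_natr -sumr_const.
  apply: ler_sum => j _; apply: hc.
  rewrite (le_trans _ yS)// !normrM !normr_nat ler_wpM2r// ler_nat.
  exact: ltnW.
rewrite lerXn2r// nnegrE ?divr_ge0//.
by apply: le_trans h; rewrite divr_ge0.
Qed.

(** * Fourier decay along a line and the mass of strips *)

Lemma measurable_dot (R : realType) (x n : R * R) :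
  measurable_fun setT (fun y : R * R => dot (y - x) n).
Proof.
apply: measurable_funD; apply: measurable_funM => //; apply: measurable_funB => //.
Qed.

Lemma cos_ge_half_near0 (R : realType) :
  exists2 c : R, 0 < c & forall z : R, `|z| <= c -> 2^-1 <= cos z.
Proof.
have := cvgr_gt _ (@continuous_cos R 0) (2^-1).
rewrite cos0 => /(_ _)[]; first by lra.
move=> d /= d0 hd; exists (d / 2); first by rewrite divr_gt0.
move=> z zd; apply/ltW/hd; rewrite /= sub0r normrN.
by apply: le_lt_trans zd _; lra.
Qed.

Lemma Rintegral_bound (d : measure_display) (T : measurableType d)
    (R : realType) (mu : {finite_measure set T -> \bar R}) (f : T -> R) :
  measurable_fun setT f -> (forall y, `|f y| <= 1) ->
  `|Rintegral mu setT f| <= fine (mu setT).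
Proof.
move=> mf bf; have fi := bounded_Rintegrable _ _ _ mu _ _ mf bf.
rewrite (le_trans (le_normr_Rintegral measurableT fi))//.
rewrite -[leRHS]mul1r -Rintegral_cst//; apply: le_Rintegral => //.
- apply: (bounded_Rintegrable _ _ _ _ _ 1) => [|y]; last by rewrite normr_id.
  exact: measurableT_comp.
- by apply: (bounded_Rintegrable _ _ _ _ _ 1) => // y; rewrite normr1.
Qed.

Lemma measurable_phase (R : realType) (xi : R * R) :
  measurable_fun setT (fun y : R * R => 2 * pi * dot y xi).
Proof.
apply: measurable_funM => //; apply: measurable_funD.
  by apply: measurable_funM.
by apply: measurable_funM.
Qed.

Lemma measurable_cos_phase (R : realType) (xi : R * R) :
  measurable_fun setT (fun y : R * R => cos (2 * pi * dot y xi)).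
Proof.
apply: measurableT_comp; last exact: measurable_phase.
by apply: continuous_measurable_fun; exact: continuous_cos.
Qed.

Lemma measurable_sin_phase (R : realType) (xi : R * R) :
  measurable_fun setT (fun y : R * R => sin (2 * pi * dot y xi)).
Proof.
apply: measurableT_comp; last exact: measurable_phase.
by apply: continuous_measurable_fun; exact: continuous_sin.
Qed.

Lemma normc_le_add (R : realType) (a b : R) :
  ComplexField.Normc.normc (Complex a b) <= `|a| + `|b|.
Proof.
rewrite /= -[leRHS]ger0_norm ?addr_ge0// -sqrtr_sqr ler_wsqrtr//.
rewrite sqrrD !real_normK ?num_real//.
have := mulr_ge0 (normr_ge0 a) (normr_ge0 b); set t := _ * _ => t0.
by rewrite mulr2n; lra.
Qed.

Lemma fourier_le (R : realType) (eta : {finite_measure set (R * R)%type -> \bar R})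
    (xi : R * R) :
  ComplexField.Normc.normc (fourier eta xi) <= 2 * fine (eta setT).
Proof.
rewrite (le_trans (normc_le_add _ _ _))// normrN [leRHS]mulr_natl mulr2n lerD//.
  by apply: Rintegral_bound => [|y]; [exact: measurable_cos_phase|exact: cos_max].
by apply: Rintegral_bound => [|y]; [exact: measurable_sin_phase|exact: sin_max].
Qed.

(** Translating by [x] only rotates the Fourier value by a phase. The subtraction formula for [cos]
    splits the integral into its real and imaginary parts; bounding each by the modulus gives the
    factor [2]. *)
Lemma Rintegral_cos_shift_le (R : realType)
    (eta : {finite_measure set (R * R)%type -> \bar R}) (x n : R * R) (m : R) :
  Rintegral eta setT (fun y => cos (m * (2 * pi * dot (y - x) n))) <=
  2 * ComplexField.Normc.normc (fourier eta (m *: n)).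
Proof.
pose b := 2 * pi * dot x (m *: n).
have -> : (fun y => cos (m * (2 * pi * dot (y - x) n))) =
   (fun y => cos b * cos (2 * pi * dot y (m *: n)) +
             sin b * sin (2 * pi * dot y (m *: n))).
  apply/funext => y; rewrite [cos b * _]mulrC [sin b * _]mulrC -cosB; congr cos.
  by rewrite /b /dot /= /GRing.scale /=; ring.
have ic : eta.-integrable setT (EFin \o fun y => cos (2 * pi * dot y (m *: n))).
  apply: (bounded_Rintegrable _ _ _ _ _ 1) => [|y]; last exact: cos_max.
  exact: measurable_cos_phase.
have isn : eta.-integrable setT (EFin \o fun y => sin (2 * pi * dot y (m *: n))).
  apply: (bounded_Rintegrable _ _ _ _ _ 1) => [|y]; last exact: sin_max.
  exact: measurable_sin_phase.
rewrite RintegralD//; last 2 first.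
- exact: (integrableZl measurableT (cos b) ic).
- exact: (integrableZl measurableT (sin b) isn).
rewrite !RintegralZl// [leRHS]mulr_natl mulr2n /fourier /=.
set I1 := Rintegral _ _ _; set I2 := Rintegral _ _ _.
apply: lerD.
  rewrite (le_trans (ler_norm _))// normrM.
  rewrite (le_trans (y := `|I1|))//; first by rewrite ler_piMl// cos_max.
  by rewrite -sqrtr_sqr ler_wsqrtr// lerDl sqr_ge0.
rewrite (le_trans (ler_norm _))// normrM.
rewrite (le_trans (y := `|I2|))//; first by rewrite ler_piMl// sin_max.
by rewrite -sqrtr_sqr ler_wsqrtr// sqrrN lerDr sqr_ge0.
Qed.

(* The shift [+ 1] makes the bound hold at every [m], including [0] where [powR]
   of a negative exponent is a junk value. *)
Lemma fourier_decay_line (R : realType)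
    (eta : {finite_measure set (R * R)%type -> \bar R}) (sigma s : R) (n : R * R) :
  0 <= s <= sigma / 2 -> fourier_decay eta sigma -> 0 < enorm n ->
  exists2 A : R, 0 < A & forall m : R,
    2 * ComplexField.Normc.normc (fourier eta (m *: n)) <= A * (`|m| + 1) `^ (- s).
Proof.
move=> /andP[s0 ssig] [C [M hCM]] n0.
pose L := enorm n.
(* For [|m| > B] three things hold: [|m| L >= M], so the decay applies; [|m| L >= 1], so the
   exponent may be weakened to [- s]; and [|m| >= 1], so [|m| + 1 <= 2 |m|]. *)
pose B := `|M| / L + L^-1 + 1.
have L0 : 0 < L by [].
have MB0 : 0 <= `|M| / L by rewrite divr_ge0// ltW.
have LV0 : 0 < L^-1 by rewrite invr_gt0.
have B0 : 0 < B + 1 by rewrite /B; lra.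
have H0 : 0 <= fine (eta setT) by rewrite fine_ge0.
have P1 : 0 < 2 * (`|C| + 1) * (2 / L) `^ s.
  by rewrite mulr_gt0 ?powR_gt0 ?divr_gt0//; have := normr_ge0 C; lra.
have P2 : 0 <= 4 * fine (eta setT) * (B + 1) `^ s.
  by rewrite mulr_ge0 ?powR_ge0//; lra.
(* The first summand handles [|m| > B] by decay, the second [|m| <= B] by the trivial bound of the
   transform by twice the total mass. *)
exists (2 * (`|C| + 1) * (2 / L) `^ s + 4 * fine (eta setT) * (B + 1) `^ s); first lra.
move=> m; rewrite [leRHS]mulrDl.
have m1 : 0 < `|m| + 1 by rewrite ltr_wpDl.
have p0 := powR_gt0 (- s) m1.
have [mB|Bm] := leP `|m| B.
  have := fourier_le _ eta (m *: n) => fb.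
  have : 1 <= (B + 1) `^ s * (`|m| + 1) `^ (- s).
    rewrite powRN ler_pdivlMr ?powR_gt0// mul1r.
    by rewrite ge0_ler_powR ?nnegrE ?(ltW m1) ?(ltW B0)//; lra.
  set q := _ `^ s * _ => q1.
  have -> : 4 * fine (eta setT) * (B + 1) `^ s * (`|m| + 1) `^ (- s) =
     4 * fine (eta setT) * q by rewrite /q mulrA.
  have : 4 * fine (eta setT) * 1 <= 4 * fine (eta setT) * q.
    by rewrite ler_wpM2l//; lra.
  have := mulr_gt0 P1 p0; lra.
apply: (@le_trans _ _ (2 * (`|C| + 1) * (2 / L) `^ s * (`|m| + 1) `^ (- s))); last first.
  by rewrite lerDl mulr_ge0// ltW.
have xiE : enorm (m *: n) = `|m| * L by rewrite enormZ.
have Lm : 1 <= `|m| * L by rewrite -ler_pdivrMr// mul1r; move: Bm; rewrite /B; lra.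
have Mxi : M <= enorm (m *: n).
  rewrite xiE (le_trans (ler_norm M))// -ler_pdivrMr//.
  by move: Bm; rewrite /B; lra.
have := hCM _ Mxi; rewrite xiE => hm.
have dec : (`|m| * L) `^ (- sigma / 2) <= (`|m| * L) `^ (- s).
  by rewrite ler_powR//; lra.
have key : (`|m| * L) `^ (- s) <= (2 / L) `^ s * (`|m| + 1) `^ (- s).
  rewrite !powRN ler_pdivlMr ?powR_gt0// mulrC ler_pdivrMr; last first.
    by rewrite powR_gt0//; lra.
  rewrite -powRM ?divr_ge0 ?mulr_ge0 ?(ltW L0)//.
  rewrite ge0_ler_powR ?nnegrE ?(ltW m1)//.
    by rewrite !mulr_ge0// ltW.
  have -> : 2 / L * (`|m| * L) = 2 * `|m| by field; rewrite gt_eqF.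
  by move: Bm; rewrite /B; lra.
rewrite -[leRHS]mulrA -[leRHS]mulrA ler_wpM2l//.
apply: (le_trans hm).
apply: (@le_trans _ _ ((`|C| + 1) * (`|m| * L) `^ (- sigma / 2))).
  by rewrite ler_wpM2r ?powR_ge0//; have := ler_norm C; lra.
by rewrite ler_wpM2l// (le_trans dec key).
Qed.

Lemma strip_measure_le (R : realType)
    (eta : {finite_measure set (R * R)%type -> \bar R}) (sigma s : R) (x n : R * R) :
  0 <= s <= sigma / 2 -> s < 1 -> fourier_decay eta sigma -> 0 < enorm n ->
  exists B d0 : R, [/\ 0 < B, 0 < d0 & forall d, 0 < d < d0 ->
    fine (eta [set y | `|dot (y - x) n| <= d]) <= B * d `^ s].
Proof.
move=> ssig s1 dec n0; have /andP[s0 _] := ssig.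
have [A A0 hA] := fourier_decay_line _ _ _ _ _ ssig dec n0.
have [c c0 hc] := cos_ge_half_near0 R.
have pi0 : 0 < pi :> R by exact: pi_gt0.
(* [8] is the [4] of [N^2 / 4] times the [2] of the double-sum bound. *)
pose D := 8 * A / (1 - s).
have D0 : 0 < D by rewrite divr_gt0 ?mulr_gt0//; lra.
exists (D * (4 * pi / c) `^ s), (c / (2 * pi)); split.
- by apply: mulr_gt0 => //; apply: powR_gt0; rewrite divr_gt0 ?mulr_gt0.
- by rewrite divr_gt0 ?mulr_gt0.
move=> d /andP[d0 dlt].
(* The largest factor for which [|dot (z - x) n| <= d] keeps the scaled phase within [c];
   [d < c / (2 * pi)] makes it at least [1]. *)
pose y := c / (2 * pi * d).
have pd0 : 0 < 2 * pi * d by rewrite !mulr_gt0.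
have y1 : 1 <= y.
  by rewrite ler_pdivlMr// mul1r ltW// mulrC -ltr_pdivlMr ?mulr_gt0.
have y0 : 0 <= y by lra.
(* [N] is of order [1 / d], so the strip lies where the Fejer kernel is at least
   [N^2 / 4], and summing the decay gives a bound of order [N^(- s)]. *)
pose N := Num.trunc y.
have N0 : (0 < N)%N by rewrite truncn_gt0.
have Ny : N%:R <= y by rewrite -truncn_ge_nat.
have yN : y < N%:R + 1 by rewrite natr1; exact: truncnS_gt.
have N1 : 1 <= N%:R :> R by rewrite ler1n.
have Np : 0 < N%:R :> R by lra.
have mg : measurable_fun setT (fun z : R * R => 2 * pi * dot (z - x) n).
  by apply: measurable_funM => //; exact: measurable_dot.
have F := fejer_le _ _ _ eta _ c N mg hc.
have sub : fine (eta [set z | `|dot (z - x) n| <= d]) <=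
    fine (eta [set z | `|N%:R * (2 * pi * dot (z - x) n)| <= c]).
  have m1 : measurable [set z | `|dot (z - x) n| <= d].
    by apply: measurable_norm_le; exact: measurable_dot.
  have m2 : measurable [set z | `|N%:R * (2 * pi * dot (z - x) n)| <= c].
    by apply: measurable_norm_le; exact: measurable_funM.
  rewrite fine_le ?fin_num_measure//.
  apply: le_measure; rewrite ?inE//.
  move=> z /= zd; rewrite normrM normr_nat normrM (gtr0_norm (x := 2 * pi)) ?mulr_gt0//.
  apply: (@le_trans _ _ (N%:R * (2 * pi * d))).
    by rewrite ler_wpM2l// ler_wpM2l// ltW// mulr_gt0.
  by rewrite -ler_pdivlMr.
apply: (le_trans sub).
move: F; set q := fine _ => F.
have S : N%:R ^+ 2 / 4 * q <= A * (2 / (1 - s) * (N%:R ^+ 2 * N%:R `^ (- s))).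
  apply: (le_trans F).
  have s01 : 0 <= s < 1 by rewrite s0 s1.
  apply: (le_trans _ (ler_wpM2l (ltW A0) (sum2_powR_dist_le _ _ N s01))).
  rewrite mulr_sumr; apply: ler_sum => j _.
  rewrite mulr_sumr; apply: ler_sum => k _.
  exact: le_trans (Rintegral_cos_shift_le _ _ _ _ _) (hA _).
have q1 : q <= D * N%:R `^ (- s).
  have NN0 : 0 < N%:R ^+ 2 / 4 :> R by rewrite divr_gt0// exprn_gt0.
  rewrite -(ler_pM2l NN0); apply: (le_trans S).
  rewrite le_eqVlt; apply/orP; left; apply/eqP; rewrite /D; field.
  by rewrite subr_eq0 eq_sym lt_eqF.
apply: (le_trans q1); rewrite -mulrA ler_wpM2l ?(ltW D0)//.
have t0 : 0 < 4 * pi / c by rewrite divr_gt0 ?mulr_gt0.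
have td0 : 0 < 4 * pi / c * d by rewrite mulr_gt0.
rewrite -powRM ?(ltW d0) ?(ltW t0)// powRN -[X in X <= _]mul1r ler_pdivrMr ?powR_gt0//.
rewrite -powRM ?(ltW td0)//.
rewrite -[leLHS](powRr0 (4 * pi / c * d * N%:R)) ler_powR//.
(* Since [y < N + 1 <= 2 N], this identity gives [4 * pi / c * d * N >= 1], which trades [N^(- s)]
   for a multiple of [d^s]. *)
have e : 4 * pi / c * d * y = 2.
  rewrite /y; move: pi0; generalize (pi : R) => p p0; field.
  by rewrite !gt_eqF.
by nra.
Qed.

(** * Euclidean balls, the support, and the mass of balls centred on the arc *)

Lemma enorm_le_add (R : realType) (x : R * R) : enorm x <= `|x.1| + `|x.2|.
Proof. exact: normc_le_add. Qed.

Lemma measurable_eball (R : realType) (x : R * R) (rho : R) : 0 < rho ->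
  measurable (eball x rho).
Proof.
move=> r0.
have -> : eball x rho = [set y : R * R | dot (y - x) (y - x) < rho ^+ 2].
  have E (w : R) : (Num.sqrt w < rho) = (w < rho ^+ 2).
    by rewrite -{1}(gtr0_norm r0) -sqrtr_sqr ltr_sqrt ?exprn_gt0.
  by apply/seteqP; split => y; rewrite /eball /= /enorm E.
have mg : measurable_fun setT (fun y : R * R => dot (y - x) (y - x)).
  by apply: measurable_funD; apply: measurable_funM; exact: measurable_funB.
have mlt : measurable_fun setT (fun y : R * R => dot (y - x) (y - x) < rho ^+ 2).
  exact: measurable_fun_ltr.
by have := mlt measurableT [set true] I; rewrite setTI.
Qed.

Lemma eball_spt_gt0 (R : realType) (eta : {finite_measure set (R * R)%type -> \bar R})
    (x : R * R) (rho : R) :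
  spt eta x -> 0 < rho -> 0 < fine (eta (eball x rho)).
Proof.
move=> sx r0.
(* The library ball is a square; with half-side [rho / 2] it fits inside the Euclidean ball, as
   [|y1| + |y2| < rho]. *)
have b0 : (0 < eta (ball x (rho / 2)))%E.
  by apply: sx; [exact: ball_open|apply: ballxx; rewrite divr_gt0].
apply: fine_gt0; rewrite ltey_eq fin_num_measure ?andbT//; last exact: measurable_eball.
apply: (lt_le_trans b0); apply: le_measure; rewrite ?inE.
- by apply: open_measurable_plane; exact: ball_open.
- exact: measurable_eball.
move=> y [/=]; rewrite /ball /= => y1 y2; rewrite /eball /=.
rewrite (le_lt_trans (enorm_le_add _ _))//= distrC [X in _ + X]distrC.
by lra.
Qed.

Lemma spt_sub_closed (R : realType)
    (eta : {finite_measure set (R * R)%type -> \bar R}) (A : set (R * R)) :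
  closed A -> eta (~` A) = 0%E -> spt eta `<=` A.
Proof.
move=> cA eA x sx; apply: contrapT => nAx.
by have := sx _ (closed_openC cA) nAx; rewrite eA ltxx.
Qed.

Lemma arc_closed (R : realType) (gamma : R -> R * R) :
  C2_embedded_arc gamma -> closed (gamma @` `[0, 1]).
Proof.
by move=> arc; rewrite -[`[0, 1]%classic]setIT; apply: arc_image_closed => //; exact: closedT.
Qed.

Lemma arc_ball_measure_le (R : realType) (gamma : R -> R * R)
    (eta : {finite_measure set (R * R)%type -> \bar R}) (sigma s t0 : R) :
  regular_C2_arc gamma -> eta (~` (gamma @` `[0, 1])) = 0%E ->
  0 <= s <= sigma / 2 -> s < 1 -> fourier_decay eta sigma -> t0 \in `[0, 1] ->
  exists B r : R, [/\ 0 < B, 0 < r & forall rho, 0 < rho < r ->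
    fine (eta (eball (gamma t0) rho)) <= B * rho `^ (2 * s)].
Proof.
move=> reg e0 ssig s1 dec t01.
have [n [K [r [n0 K0 r0 hstrip]]]] := arc_in_strip _ _ _ reg t01.
have [B [d0 [B0 d00 hB]]] := strip_measure_le _ _ _ _ (gamma t0) _ ssig s1 dec n0.
(* The bounds [rho < 1] and [rho < d0 / K] give [K rho^2 <= K rho < d0], so the strip estimate
   applies. *)
exists (B * K `^ s), (Num.min r (Num.min 1 (d0 / K))); split.
- by rewrite mulr_gt0// powR_gt0.
- by rewrite !lt_min r0 ltr01 divr_gt0.
move=> rho; rewrite !lt_min => /andP[rho0 /and3P[rr r1 rd]].
have Krho0 : 0 < K * rho ^+ 2 by rewrite mulr_gt0// exprn_gt0.
have Krho : K * rho ^+ 2 < d0.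
  move: rd; rewrite ltr_pdivlMr// mulrC; apply: le_lt_trans.
  by rewrite ler_wpM2l ?(ltW K0)// expr2 ler_piMl// ltW.
have := hB (K * rho ^+ 2); rewrite Krho0 Krho => /(_ isT).
have -> : B * (K * rho ^+ 2) `^ s = B * K `^ s * rho `^ (2 * s).
  by rewrite powRM ?(ltW K0) ?exprn_ge0 ?(ltW rho0)// powRrM powR_mulrn ?(ltW rho0)// mulrA.
apply: le_trans; set S := [set y | _].
have mS : measurable S by apply: measurable_norm_le; exact: measurable_dot.
have mC : measurable (~` (gamma @` `[0, 1])).
  apply: open_measurable_plane; apply: closed_openC; apply: arc_closed.
  by case: reg.
have mE := measurable_eball _ (gamma t0) _ rho0.
rewrite fine_le ?fin_num_measure//.
(* The strip contains only the part of the ball on the arc; the rest lies in the null complement. *)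
rewrite (@le_trans _ _ (eta (S `|` ~` (gamma @` `[0, 1]))))//.
  apply: le_measure; rewrite ?inE//; first exact: measurableU.
  move=> y yb; have [[t tt01 ty]|] := pselect ((gamma @` `[0, 1]) y); last by right.
  by left; rewrite /S /= -ty; apply: (hstrip t) => //; rewrite ty.
have := measureU2 eta mS mC => /le_trans; apply.
by rewrite [X in (_ + X)%E]e0 adde0.
Qed.

(** * From ball masses to local dimension, and the conclusion *)

(** Dividing [ln eta(ball) <= ln B + d ln rho] by [ln rho < 0] reverses it; the gap [d - c] absorbs
    the constant [B] at small scales. *)
Lemma lower_local_dim_ge (R : realType)
    (eta : {finite_measure set (R * R)%type -> \bar R}) (x : R * R) (B r d c : R) :
  0 < B -> 0 < r -> c < d ->
  (forall rho, 0 < rho < r -> 0 < fine (eta (eball x rho)) <= B * rho `^ d) ->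
  (c%:E <= lower_local_dim eta x)%E.
Proof.
move=> B0 r0 cd h; rewrite /lower_local_dim limf_einfE.
(* The last bound says [ln B + (d - c) ln rho < 0]; the bound [1] makes [ln rho] negative. *)
pose r' := Num.min r (Num.min 1 (expR (- ln B / (d - c)))).
have r'0 : 0 < r' by rewrite !lt_min r0 ltr01 expR_gt0.
(* The lower limit is a supremum of infima over neighbourhoods, so one neighbourhood suffices. *)
apply: le_ereal_sup_tmp.
exists (ereal_inf ((fun rho => (log2 (fine (eta (eball x rho))) / log2 rho)%:E) @`
  [set rho | 0 < rho < r'])).
  exists [set rho | 0 < rho < r'] => //.
  by apply: filterS2 (nbhs_right_gt 0) (nbhs_right_lt r'0) => y /= -> ->.
apply: le_ereal_inf_tmp => _ [rho /= /andP[rho0 rhor'] <-].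
move: rhor'; rewrite !lt_min => /and3P[rhor rho1 rhoB].
have := h rho; rewrite rho0 rhor => /(_ isT) /andP[q0 qB].
rewrite lee_fin /log2.
have l2 : 0 < ln 2 :> R by rewrite ln_gt0// ltr1n.
have lr : ln rho < 0 by rewrite ln_lt0// rho0.
have -> : ln (fine (eta (eball x rho))) / ln 2 / (ln rho / ln 2) =
    ln (fine (eta (eball x rho))) / ln rho.
  by rewrite invf_div mulrA divfK// gt_eqF.
rewrite ler_ndivlMr//.
apply: (@le_trans _ _ (ln B + d * ln rho)).
  have p0 : 0 < rho `^ d by exact: powR_gt0.
  by rewrite -ln_powR -lnM ?posrE// ler_ln ?posrE// mulr_gt0.
have dc : 0 < d - c by lra.
have : ln rho < - ln B / (d - c).
  by rewrite -ltr_expR lnK ?posrE.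
by rewrite ltr_pdivlMr//; nra.
Qed.

Lemma regular_arc_fourier_dim_le (R : realType) (gamma : R -> R * R)
    (eta : {finite_measure set (R * R)%type -> \bar R}) :
  regular_C2_arc gamma -> eta (~` (gamma @` `[0, 1])) = 0%E ->
  ((fourier_dim eta)%:E <= alpha_min eta)%E.
Proof.
move=> reg e0; apply: le_ereal_inf_tmp => _ [x sx <-].
have [t0 t01 xE] : (gamma @` `[0, 1]) x.
  by apply: (spt_sub_closed _ _ _ (arc_closed _ _ (proj1 reg)) e0).
apply/lee_subgt0Pr => e egt0; rewrite -EFinB.
have : fourier_dim eta - e < fourier_dim eta by lra.
set c := _ - e; rewrite /fourier_dim => csup.
have [|sigma [/andP[sig0 sig2] dec] csig] := sup_gt _ csup.
  (* The exponent [0] is always admissible because the transform is bounded, so the supremum is over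
     a nonempty set. *)
  exists 0; split; first by rewrite lexx ler0n.
  exists (2 * fine (eta setT)), 0 => xi _.
  by rewrite oppr0 mul0r powRr0 mulr1; exact: fourier_le.
(* [s] must be [< 1] even when [sigma = 2]. *)
pose s := Num.max 0 ((c + sigma) / 4).
have s0 : 0 <= s by rewrite le_max lexx.
have ssig : s <= sigma / 2.
  by rewrite ge_max; apply/andP; split; lra.
have s1 : s < 1 by rewrite gt_max ltr01; lra.
(* [2 * s] is at least the midpoint of [c] and [sigma], and [c < sigma]. *)
have cs : c < 2 * s.
  have : (c + sigma) / 4 <= s by rewrite le_max lexx orbT.
  by lra.
have ss : 0 <= s <= sigma / 2 by rewrite s0.
have [B [r [B0 r0 hB]]] := arc_ball_measure_le _ _ _ _ _ _ reg e0 ss s1 dec t01.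
apply: (lower_local_dim_ge _ _ _ _ _ _ _ B0 r0 cs) => rho /andP[rho0 rhor].
rewrite eball_spt_gt0//= -xE; apply: hB.
by rewrite rho0.
Qed.

Theorem proposition5p10 (R : realType) (gamma : R -> R * R) :
  (regular_C2_arc gamma ->
   forall eta : {finite_measure set (R * R)%type -> \bar R},
     eta setT <> 0%E -> eta (~` (gamma @` `[0, 1])) = 0%E ->
     ((fourier_dim eta)%:E <= alpha_min eta)%E) /\
  (nondegenerate_C2_arc gamma ->
   forall eta : {finite_measure set (R * R)%type -> \bar R},
     eta setT <> 0%E -> eta (~` (gamma @` `[0, 1])) = 0%E ->
     ((fourier_dim eta)%:E <= alpha_min eta)%E).
Proof.
split=> [reg|[reg _]] eta _ e0; exact: regular_arc_fourier_dim_le reg e0.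
Qed.
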